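(* For all $v\in(0,1]$, $w\in(0,1]$ and all integers $x\le b$ with $b\ge 0$, $$E_x\big[v^{\tau_{-1}^-}w^{-X(\tau_{-1}^-)};\tau_{-1}^-<\tau_b^+\big]=Z_v(x,w)-\frac{W_v(x)}{W_v(b)}Z_v(b,w).$$
   Context: Notation: $\mathbb{N}=\{1,2,\dots\}$, $\mathbb{N}_0=\{0,1,2,\dots\}$; $E[Y;A]:=E[Y\mathbf{1}_A]$; $\inf\emptyset=\infty$. Let $(p_k)_{k\in\mathbb{N}_0}$ be a probability mass function on $\mathbb{N}_0$ with $p_0>0$, and let $C_1,C_2,\dots$ be i.i.d. with $P(C_1=k)=p_k$. Let $X_n=X_0+n-\sum_{i=1}^nC_i$, $n\in\mathbb{N}_0$; for $x\in\mathbb{Z}$, $P_x$ (expectation $E_x$) is the law under which $X_0=x$, and $P=P_0$, $E=E_0$. For $b\in\mathbb{Z}$ let $\tau_b^-=\inf\{n\in\mathbb{N}_0:X_n\le b\}$ and $\tau_b^+=\inf\{n\in\mathbb{N}_0:X_n\ge b\}$. For $v\in(0,1]$: $W_v(y):=\big(p_0E[v^{\tau_y^+};\tau_y^+<\tau_{-1}^-]\big)^{-1}$ for $y\in\mathbb{N}_0$, and $W_v(y):=0$ for integers $y<0$. For $v,w\in(0,1]$ and $x\in\mathbb{Z}$: $\Psi_v(x,w):=E_x[v^{\tau_{-1}^-}w^{-X(\tau_{-1}^-)};\tau_{-1}^-<\infty]$ and $Z_v(x,w):=\Psi_v(x,w)+\alpha_v(w)W_v(x)$, where the constant $\alpha_v(w)\in[0,\infty)$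 is chosen so that $Z_v(0,w)=1$. *)

(* Defs.v *)
From HB Require Import structures.
From mathcomp Require Import all_boot all_order all_algebra.
From mathcomp Require Import all_classical all_reals all_analysis.

Set Implicit Arguments.
Unset Strict Implicit.
Unset Printing Implicit Defensive.

Import Order.TTheory GRing.Theory Num.Theory.

Local Open Scope classical_set_scope.
Local Open Scope ring_scope.

Definition is_pmf (R : realType) (p : nat -> R) : Prop :=
  (forall k, 0 <= p k) /\ (\sum_(0 <= k <oo) (p k)%:E = 1)%E.

Definition mutually_independent d d' (T : measurableType d)
    (T' : measurableType d') (R : realType) (P : probability T R)
    (C : nat -> {RV P >-> T'}) : Prop :=
  forall (J : seq nat) (B : nat -> set T'), uniq J ->
    (forall j, measurable (B j)) ->
    P (\big[setI/setT]_(j <- J) (C j @^-1` B j)) =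
    (\prod_(j <- J) P (C j @^-1` B j))%E.

Definition iid_with_pmf d (T : measurableType d) (R : realType)
    (P : probability T R) (C : nat -> {RV P >-> nat}) (p : nat -> R) : Prop :=
  mutually_independent C /\
  forall i k, P (C i @^-1` [set k]) = (p k)%:E.

(* Times with values in {0, 1, 2, ...} and infinity, the latter being [None]. *)
Definition first_time (Q : pred nat) : option nat :=
  if pselect (exists n, Q n) is left ex then Some (ex_minn ex) else None.

Definition time_lt (s t : option nat) : bool :=
  match s, t with
  | Some m, Some n => (m < n)%N
  | Some _, None => true
  | None, _ => false
  end.

(* First passage at or below b, and at or above b, for a trajectory X. *)
Definition tau_minus (b : int) (X : nat -> int) : option nat :=
  first_time (fun n => X n <= b).

Definition tau_plus (b : int) (X : nat -> int) : option nat :=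
  first_time (fun n => b <= X n).

(* The values of [discount] and [stopped] at [None] are irrelevant: they are
   only used on events where the time is finite. *)
Definition discount (R : realType) (v : R) (t : option nat) : R :=
  if t is Some n then v ^+ n else 0.

Definition stopped (X : nat -> int) (t : option nat) : int :=
  if t is Some n then X n else 0.

Section walk.
Context d (T : measurableType d) (R : realType) (P : probability T R).
Variables (C : nat -> {RV P >-> nat}) (p : nat -> R).

(* The trajectory started at x; the i-th jump C_i, i >= 1, is [C i.-1]. *)
Definition walk (x : int) (om : T) (n : nat) : int :=
  x + n%:Z - \sum_(i < n) (C i om)%:Z.

(* E_x[Y; A], where the integrand Y and the event A are functions of the
   trajectory: the law P_x is that of [walk x] under P. *)
Definition E_on (x : int) (Y : (nat -> int) -> R) (A : set (nat -> int)) :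
    \bar R :=
  ('E_P[fun om => (Y (walk x om) * \1_A (walk x om))%R])%E.

(* For v, w in (0, 1] the expectations below are in [0, 1], so that [fine]
   loses nothing. *)
Definition W (v : R) (y : int) : R :=
  if 0 <= y then
    (p 0%N * fine (E_on 0 (fun X => discount v (tau_plus y X))
      [set X | time_lt (tau_plus y X) (tau_minus (-1) X)]))^-1
  else 0.

Definition exit_below (v w : R) (X : nat -> int) : R :=
  discount v (tau_minus (-1) X) * w ^ (- stopped X (tau_minus (-1) X)).

Definition Psi (v : R) (x : int) (w : R) : R :=
  fine (E_on x (exit_below v w) [set X | time_lt (tau_minus (-1) X) None]).

(* The a >= 0 for which Psi v 0 w + a * W v 0 = 1, i.e. Z v 0 w = 1. *)
Definition alpha (v w : R) : R :=
  xget 0 [set a : R | 0 <= a /\ Psi v 0 w + a * W v 0 = 1].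

Definition Z (v : R) (x : int) (w : R) : R :=
  Psi v x w + alpha v w * W v x.

End walk.

(* Main.v *)
Require Import Defs.
From HB Require Import structures.
From mathcomp Require Import all_boot all_order all_algebra.
From mathcomp Require Import all_classical all_reals all_analysis.
From mathcomp Require Import zify ring.

Set Implicit Arguments.
Unset Strict Implicit.
Unset Printing Implicit Defensive.

Import Order.TTheory GRing.Theory Num.Theory.

Local Open Scope classical_set_scope.
Local Open Scope ring_scope.

(** Up to time n the walk is a function of the finite word of its first n
    jumps, so every expectation in the statement is a sum over words.  The
    trajectories that enter a target region Q before a forbidden region N
    correspond to the prefix-free set [hits Q N x] of words stopping exactly
    at the entrance into Q, and by independence a word s has probability
    [\prod_(c <- s) p c].  Hence (lemma [E_on_hit_sum]) each expectation equals
    a [hit_sum], the sum over [hits Q N x] of the multiplicative weight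
    [\prod_(c <- s) (v * p c)] times a function of the endpoint.

    In this form the strong Markov property is concatenation of words.  If a
    third region M can only be entered at the single site y, a word of
    [hits Q N x] either avoids M or factors uniquely as a word stopped at the
    entrance into M followed by a word of [hits Q N y]; the weight splits
    accordingly ([hit_sum_strong_markov]).  The walk climbs by at most one per
    step, so it can only enter a half-line [b, oo) at b.

    Write A(x, b) = E_x[v^tau_b^+; tau_b^+ < tau_(-1)^-] for x <= b.
    - Splitting the passage from 0 to b at a level x >= 0 gives
      A(0, b) = A(0, x) A(x, b) ([ascent_split]), that is
      A(x, b) = W(x) / W(b); for x < 0 both sides are 0.
    - Splitting the passage below 0 at level b gives
      Psi(x) = L(x) + A(x, b) Psi(b), where L(x) is the expectation to be
      computed ([descent_split]).
    So L(x) = Psi(x) - W(x) / W(b) * Psi(b).  Adding alpha * W to Psi changes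
    nothing on the right-hand side, because W(x) - W(x) / W(b) * W(b) = 0:
    Psi may be replaced by Z whatever the value of alpha. *)

(** * Sums of nonnegative families *)

Lemma esumZl (R : realType) (I : choiceType) (S : set I) (r : R)
    (a : I -> \bar R) : 0 <= r -> (forall i, (0 <= a i)%E) ->
  (\esum_(i in S) (r%:E * a i) = r%:E * \esum_(i in S) a i)%E.
Proof.
move=> r0 a0; rewrite /esum -ereal_supZl//; last first.
  apply/set0P; exists (\sum_(i \in set0) a i)%E.
  by exists set0 => //; exact: fsets_set0.
congr ereal_sup; rewrite image_comp; apply: eq_imagel => A [finA AS] /=.
by rewrite ge0_mule_fsumr.
Qed.

(** Measures are additive along sequences of sets, whereas words form a
    countable type: this carries sums from words over to such sequences. *)
Lemma esum_pickle (R : realType) (I : countType) (S : set I)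
    (a : I -> \bar R) : (forall i, S i -> (0 <= a i)%E) ->
  (\esum_(i in S) a i = \sum_(0 <= k <oo)
    (if @pickle_inv I k is Some i then if i \in S then a i else 0 else 0))%E.
Proof.
move=> a0; pose F k : \bar R :=
  if @pickle_inv I k is Some i then if i \in S then a i else 0%E else 0%E.
change (\esum_(i in S) a i = \sum_(0 <= k <oo) F k)%E.
have FE i : S i -> F (pickle i) = a i.
  by move=> Si; rewrite /F pickleK_inv mem_set.
rewrite nneseries_esumT; last first.
  move=> k; rewrite /F; case: pickle_inv => // i.
  by case: ifPn => // /set_mem/a0.
rewrite (eq_esum (b := F \o pickle)); last by move=> i Si /=; rewrite FE.
rewrite -(esum_image S pickle F); last first.
  by move=> i j _ _; exact: (pcan_inj pickleK_inv).
rewrite esum_mkcond; apply: eq_esum => k _; case: ifPn => // /negP kS.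
rewrite /F; case E : pickle_inv => [i|//]; case: ifPn => // /set_mem Si.
exfalso; apply: kS; rewrite inE; exists i => //.
by have := @pickle_invK I k; rewrite E.
Qed.

(** * Words of jumps and first entrances *)

Definition endpoint (x : int) (s : seq nat) : int :=
  x + (size s)%:Z - \sum_(c <- s) c%:Z.

Lemma endpoint_cat x s t : endpoint x (s ++ t) = endpoint (endpoint x s) t.
Proof. by rewrite /endpoint size_cat big_cat/= PoszD; ring. Qed.

Lemma endpoint_nil x : endpoint x [::] = x.
Proof. by rewrite /endpoint big_nil subr0 addr0. Qed.

Lemma endpoint_rcons x s c :
  endpoint x (rcons s c) = endpoint x s + 1 - c%:Z.
Proof. by rewrite -cats1 endpoint_cat /(endpoint _ [:: c]) big_seq1. Qed.

(** Words of jumps after which a walk started at x is in Q for the first time,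
    having avoided N strictly before.  The forbidden region N is not tested at
    the endpoint: the two regions are disjoint in the applications. *)
Definition hits (Q N : pred int) (x : int) : set (seq nat) :=
  [set s | Q (endpoint x s) /\ forall k, (k < size s)%N ->
     ~~ Q (endpoint x (take k s)) /\ ~~ N (endpoint x (take k s))].

Definition prefix_free (S : set (seq nat)) : Prop :=
  forall s s', S s -> S s' -> prefix s s' -> s = s'.

Lemma hits_prefix_free Q N x : prefix_free (hits Q N x).
Proof.
move=> s s' [Qs _] [_ Hs'] /prefixP[t st]; case: t st => [|c t] st.
  by rewrite st cats0.
have /Hs'[] : (size s < size s')%N by rewrite st size_cat /=; lia.
by rewrite st take_size_cat// Qs.
Qed.

(** Unique factorization: of two words with the same concatenation the
    shorter first factor is a prefix of the other. *)
Lemma cat_inj_prefix_free (S : set (seq nat)) s s' t t' : prefix_free S ->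
  S s -> S s' -> s ++ t = s' ++ t' -> (s, t) = (s', t').
Proof.
move=> free Ss Ss' e; suff ss' : s = s'.
  by move: e; rewrite ss' => /eqP; rewrite eqseq_cat// => /andP[_ /eqP ->].
have [le|le] := leqP (size s) (size s').
  apply: free => //; apply/prefixP; exists (drop (size s) s').
  have := congr1 (take (size s)) e; rewrite take_size_cat// takel_cat// => h.
  by rewrite {1}h cat_take_drop.
apply/esym; apply: free => //; apply/prefixP; exists (drop (size s') s).
have := congr1 (take (size s')) e.
rewrite [in RHS]take_size_cat// takel_cat ?(ltnW le)// => h.
by rewrite -{1}h cat_take_drop.
Qed.

(** Upward skip-freeness: the last jump raises the walk by at most one from a
    position strictly below y. *)
Lemma hits_up_endpoint (y x : int) (N : pred int) s : x <= y ->
  hits (fun z => y <= z) N x s -> endpoint x s = y.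
Proof.
move=> xy [ys]; case/lastP: s ys => [|s c] ys Hs.
  by move: ys; rewrite endpoint_nil; lia.
have /Hs[+ _] : (size s < size (rcons s c))%N by rewrite size_rcons.
move: ys; rewrite endpoint_rcons -cats1 take_size_cat//; lia.
Qed.

(** The words that visit M are cut at their first visit, which happens at y.
    The first factor must avoid Q until then, hence the forbidden region N
    enlarged by Q outside of M; the words that never visit M have M as an
    additional forbidden region. *)
Lemma hits_decomp (Q N M : pred int) x y :
  (forall s, hits M (fun z => N z || Q z && ~~ M z) x s -> endpoint x s = y) ->
  let B := [set s : seq nat |
    exists2 k, (k <= size s)%N & M (endpoint x (take k s))] in
  hits Q N x `&` B =
    [set st.1 ++ st.2 | st in hits M (fun z => N z || Q z && ~~ M z) x
                               `*` hits Q N y] /\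
  hits Q N x `&` ~` B =
    hits (fun z => Q z && ~~ M z) (fun z => N z || M z) x.
Proof.
move=> Mend B; split; apply/seteqP; split=> s /=.
- move=> [[Qs Hs] [k0 k0s Mk0]].
  (* k is the time of the first visit to M *)
  have [k Mk kmin] : exists2 k, ((k <= size s)%N && M (endpoint x (take k s))) &
      forall j, ((j <= size s)%N && M (endpoint x (take j s))) -> (k <= j)%N.
    have ex : exists k, (k <= size s)%N && M (endpoint x (take k s)).
      by exists k0; rewrite k0s.
    by case: (ex_minnP ex) => k Mk kmin; exists k.
  have /andP[ks Mks] := Mk.
  have sz : size (take k s) = k by rewrite size_takel.
  have Hk : hits M (fun z => N z || Q z && ~~ M z) x (take k s).
    split=> // j; rewrite sz => jk; rewrite take_takel ?(ltnW jk)//.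
    have /Hs[nQ nN] := leq_trans jk ks.
    split; last by rewrite negb_or nN (negbTE nQ).
    apply/negP => Mj; have := kmin j; rewrite Mj (leq_trans (ltnW jk) ks).
    by move=> /(_ isT); rewrite leqNgt jk.
  exists (take k s, drop k s); last by rewrite /= cat_take_drop.
  split=> //=; rewrite -(Mend _ Hk); split.
    by rewrite -endpoint_cat cat_take_drop.
  move=> j; rewrite size_drop => js; rewrite -endpoint_cat -takeD.
  by apply: Hs; lia.
- move=> [[t u] [/= Ht Hu] <-]; have te := Mend _ Ht.
  case: Ht => Mt Ht; case: Hu => Qu Hu; split; last first.
    exists (size t); first by rewrite size_cat leq_addr.
    by rewrite take_size_cat.
  split; first by rewrite endpoint_cat te.
  move=> k; rewrite size_cat take_cat => kt; case: ltnP => tk.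
    have [nM] := Ht _ tk; rewrite negb_or nM andbT => /andP[-> ->]//.
  by rewrite endpoint_cat te; apply: Hu; lia.
- move=> [[Qs Hs] nB]; split.
    rewrite Qs /=; apply/negP => Ms; apply: nB; exists (size s) => //.
    by rewrite take_size.
  move=> k ks; have [nQ nN] := Hs _ ks; rewrite (negbTE nQ) (negbTE nN)/=.
  by split=> //; apply/negP => Mk; apply: nB; exists k => //; exact: ltnW.
- move=> [/andP[Qs nMs] Hs]; split; [split=> // k ks|].
    have [+ ] := Hs _ ks.
    by rewrite negb_or => + /andP[-> nM]; rewrite nM andbT.
  move=> [k + Mk]; rewrite leq_eqVlt => /predU1P[ks|/Hs[_]].
    by move: nMs; rewrite -{1}(take_size s) -ks Mk.
  by rewrite Mk orbT.
Qed.

(** * Weighted sums over first entrances *)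

Section path_sums.
Context (R : realType).
Variables (p : nat -> R) (v : R).
Hypotheses (p_ge0 : forall k, 0 <= p k) (v_ge0 : 0 <= v).

(** For a word s this is v ^ (size s) times the probability of s; the discount
    is distributed over the letters to make the weight multiplicative. *)
Definition weight (s : seq nat) : R := \prod_(c <- s) (v * p c).

Definition hit_sum (Q N : pred int) (h : int -> R) (x : int) : \bar R :=
  \esum_(s in hits Q N x) (weight s * h (endpoint x s))%:E.

Lemma weight_ge0 s : 0 <= weight s.
Proof. by apply: prodr_ge0 => c _; rewrite mulr_ge0. Qed.

Lemma weight_cat s t : weight (s ++ t) = weight s * weight t.
Proof. by rewrite /weight big_cat. Qed.

Lemma hit_sum_ge0 Q N h x : (forall y, 0 <= h y) -> (0 <= hit_sum Q N h x)%E.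
Proof.
by move=> h0; apply: esum_ge0 => s _; rewrite lee_fin mulr_ge0 ?weight_ge0.
Qed.

(** Strong Markov property at the entrance into M, which takes place at y:
    unique factorization turns the sum over the words visiting M into a
    product of two sums. *)
Lemma hit_sum_strong_markov (Q N M : pred int) h x y :
  (forall z, 0 <= h z) -> hit_sum Q N h y \is a fin_num ->
  let N' := fun z => N z || Q z && ~~ M z in
  (forall s, hits M N' x s -> endpoint x s = y) ->
  (hit_sum Q N h x =
   hit_sum M N' (fun=> 1%R) x * hit_sum Q N h y +
   hit_sum (fun z => Q z && ~~ M z) (fun z => N z || M z) h x)%E.
Proof.
move=> h0 hfin N' Mend; have [dec1 dec2] := hits_decomp Mend.
have wh0 x' s : (0 <= (weight s * h (endpoint x' s))%:E)%E.
  by rewrite lee_fin mulr_ge0 ?weight_ge0.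
(* split the sum according to whether the word visits M *)
have B := esumID [set s : seq nat |
    exists2 k, (k <= size s)%N & M (endpoint x (take k s))] (hits Q N x).
rewrite {1}/hit_sum B//; congr (_ + _)%E; last by rewrite dec2.
rewrite dec1 esum_image; last first.
  move=> [s t] [s' t']; rewrite !inE /= => -[Hs _] [Hs' _].
  exact: (cat_inj_prefix_free (@hits_prefix_free M N' x) Hs Hs').
rewrite -(fineK hfin) [in RHS]muleC /hit_sum -esumZl; last 2 first.
- by rewrite fine_ge0// hit_sum_ge0.
- by move=> s; rewrite lee_fin mulr1 weight_ge0.
have -> : hits M N' x `*` hits Q N y = hits M N' x `*`` (fun=> hits Q N y).
  by apply/seteqP; split.
rewrite -(esum_esum (a := fun s t =>
  (weight (s ++ t) * h (endpoint x (s ++ t)))%:E)); last first.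
  by move=> s t _ _; exact: wh0.
apply: eq_esum => s Hs; rewrite mulr1 fineK// muleC -esumZl ?weight_ge0//.
by apply: eq_esum => t _; rewrite weight_cat endpoint_cat Mend// -EFinM mulrA.
Qed.

End path_sums.

(** * Cylinder events and expectations *)

Section walk_law.
Context d (T : measurableType d) (R : realType) (P : probability T R).
Variables (C : nat -> {RV P >-> nat}) (p : nat -> R).
Hypotheses (p_ge0 : forall k, 0 <= p k) (C_iid : iid_with_pmf C p).

Definition jumps (om : T) (n : nat) : seq nat := [seq C i om | i <- iota 0 n].

Definition cylinder (s : seq nat) : set T := [set om | jumps om (size s) = s].

Lemma size_jumps om n : size (jumps om n) = n.
Proof. by rewrite size_map size_iota. Qed.

Lemma take_jumps om k n : (k <= n)%N -> take k (jumps om n) = jumps om k.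
Proof. by move=> kn; rewrite -map_take take_iota (minn_idPl kn). Qed.

Lemma walkE x om n : walk C x om n = endpoint x (jumps om n).
Proof.
rewrite /walk /endpoint size_jumps big_map -[n in iota 0 n]subn0.
by rewrite -/(index_iota 0 n) big_mkord.
Qed.

Lemma cylinderE s : cylinder s =
  \big[setI/setT]_(j <- iota 0 (size s)) (C j @^-1` [set nth 0%N s j]).
Proof.
rewrite -bigcap_seq; apply/seteqP; split=> om /=.
  move=> e j /=; rewrite mem_iota add0n => /= js.
  by rewrite /= -[s in RHS]e (nth_map 0%N) ?size_iota// nth_iota.
move=> H; apply: (@eq_from_nth _ 0%N); rewrite size_jumps// => i si.
rewrite (nth_map 0%N) ?size_iota// nth_iota// add0n.
by apply: H; rewrite /= mem_iota.
Qed.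

Lemma measurable_cylinder s : measurable (cylinder s).
Proof.
rewrite cylinderE; apply: bigsetI_measurable => j _.
exact: measurable_funPTI.
Qed.

Lemma probability_cylinder s : P (cylinder s) = (\prod_(c <- s) p c)%:E.
Proof.
have [ind law] := C_iid.
rewrite cylinderE (ind _ (fun j => [set nth 0%N s j])) ?iota_uniq//.
rewrite (eq_bigr (fun j => (p (nth 0%N s j))%:E)); last first.
  by move=> j _; exact: law.
rewrite prodEFin; congr EFin.
by rewrite [in RHS](big_nth 0%N) /index_iota subn0.
Qed.

(** A trajectory has at most one initial segment in a prefix-free set. *)
Lemma cylinder_inj S s s' om : prefix_free S -> S s -> S s' ->
  cylinder s om -> cylinder s' om -> s = s'.
Proof.
move=> free Ss Ss' es es'.
have [le|le] := leqP (size s) (size s').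
  apply: free => //; rewrite -es -es' -(take_jumps _ le); exact: prefix_take.
apply/esym; apply: free => //.
rewrite -es -es' -(take_jumps _ (ltnW le)); exact: prefix_take.
Qed.

Let slice (S : set (seq nat)) (k : nat) : set T :=
  if @pickle_inv (seq nat) k is Some s then
    if s \in S then cylinder s else set0
  else set0.

Let measurable_slice S k : measurable (slice S k).
Proof.
rewrite /slice; case: pickle_inv => // s.
by case: ifP => // _; exact: measurable_cylinder.
Qed.

Let trivIset_slice S : prefix_free S -> trivIset setT (slice S).
Proof.
move=> free i j _ _ [om [+ +]]; rewrite /slice.
have := @pickle_invK (seq nat) i; have := @pickle_invK (seq nat) j.
case: pickle_inv => // s' /= <-; case: pickle_inv => // s /= <-.
case: ifP => // /set_mem Ss cs; case: ifP => // /set_mem Ss' cs'.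
by congr pickle; exact: cylinder_inj free Ss Ss' cs cs'.
Qed.

(** Kraft's inequality: the cylinders over a prefix-free set are pairwise
    disjoint events.  It bounds all the sums over words below. *)
Lemma kraft S : prefix_free S ->
  (\esum_(s in S) (\prod_(c <- s) p c)%:E <= 1)%E.
Proof.
move=> free; rewrite esum_pickle; last first.
  by move=> s _; rewrite lee_fin prodr_ge0.
rewrite (eq_eseriesr (g := fun k => P (slice S k))); last first.
  move=> k _; rewrite /slice; case: pickle_inv => [s|]; last by rewrite measure0.
  by case: ifP => _; rewrite ?measure0 ?probability_cylinder.
rewrite (eq_eseriesl (Q := fun k => k \in [set: nat])); last first.
  by move=> k; rewrite in_setT.
rewrite -measure_bigcup//; last exact: trivIset_slice.
exact/probability_le1/bigcup_measurable.
Qed.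

(** A random variable determined by the initial segment in S is constant on
    each of the countably many disjoint cylinders over S; this gives both its
    measurability and the value of its integral, as it vanishes elsewhere. *)
Lemma expectation_prefix_free S (f : T -> R) (g : seq nat -> R) :
  prefix_free S -> (forall s, 0 <= g s) ->
  (forall s om, S s -> cylinder s om -> f om = g s) ->
  (forall om, (forall s, S s -> ~ cylinder s om) -> f om = 0) ->
  ('E_P[f])%E = \esum_(s in S) (\prod_(c <- s) p c * g s)%:E.
Proof.
move=> free g0 fS f0; rewrite unlock.
have sliceP om k : slice S k om ->
    exists s, [/\ S s, cylinder s om & @pickle_inv (seq nat) k = Some s].
  rewrite /slice; case: pickle_inv => // s; case: ifPn => // /set_mem Ss cs.
  by exists s.
have sliceE s : S s -> slice S (pickle s) = cylinder s.
  by move=> Ss; rewrite /slice pickleK_inv mem_set.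
(* D is the event that some initial segment lies in S; f vanishes off D *)
pose D := \bigcup_k slice S k.
have fD : (fun om => (f om)%:E) = (fun om => (f om)%:E) \_ D.
  apply/funext => om; rewrite patchE; case: ifPn => // /negP nD.
  rewrite f0// => s Ss cs; apply: nD; rewrite inE; exists (pickle s) => //.
  by rewrite sliceE.
rewrite [X in integral _ _ X]fD -integral_mkcond ge0_integral_bigcup//.
- rewrite esum_pickle; last first.
    by move=> s _; rewrite lee_fin mulr_ge0// prodr_ge0.
  apply: eq_eseriesr => k _.
  case E : (@pickle_inv (seq nat) k) => [s|]; last first.
    by rewrite /slice E integral_set0.
  case: ifPn => Ss; last by rewrite /slice E (negbTE Ss) integral_set0.
  rewrite /slice E Ss.
  rewrite (eq_integral (cst (g s)%:E)); last first.
    by move=> om /set_mem cs; rewrite (fS s)//; exact: set_mem.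
  rewrite mulrC EFinM -probability_cylinder.
  exact: integral_cst (measurable_cylinder s) _.
- apply/measurable_fun_bigcup => // k.
  have [->|/set0P[om0 om0k]] := eqVneq (slice S k) set0.
    exact: measurable_fun_set0.
  have [s0 [Ss0 _ Es0]] := sliceP _ _ om0k.
  have cst_k : {in slice S k, cst (g s0)%:E =1 (fun om => (f om)%:E)}.
    move=> om /set_mem/sliceP[s [Ss cs]]; rewrite Es0 => -[es].
    by rewrite es (fS s).
  by apply: eq_measurable_fun; [exact: cst_k|exact: measurable_cst].
- move=> om [k _ /sliceP[s [Ss cs _]]].
  by rewrite (fS s)// lee_fin.
- exact: trivIset_slice.
Qed.

End walk_law.

(** * First times of the walk *)

Lemma first_time_some (Q : pred nat) n :
  Q n -> (forall k, (k < n)%N -> ~~ Q k) -> first_time Q = Some n.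
Proof.
move=> Qn nQ; rewrite /first_time; case: pselect => [ex|[]]; last by exists n.
congr Some; case: ex_minnP => m Qm /(_ _ Qn) mn; apply/eqP.
rewrite eqn_leq mn leqNgt; apply/negP => /nQ.
by rewrite Qm.
Qed.

Variant first_time_spec (Q : pred nat) : option nat -> Prop :=
| FirstTime n of Q n & (forall k, (k < n)%N -> ~~ Q k) :
    first_time_spec Q (Some n)
| FirstTimeNever of (forall k, ~~ Q k) : first_time_spec Q None.

Lemma first_timeP (Q : pred nat) : first_time_spec Q (first_time Q).
Proof.
rewrite /first_time; case: pselect => [ex|nex]; last first.
  by constructor => k; apply/negP => Qk; apply: nex; exists k.
case: ex_minnP => n Qn nmin; constructor => // k kn; apply/negP => /nmin.
by rewrite leqNgt kn.
Qed.

(** As Q and N never hold together, comparing the two first times amounts to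
    N not holding strictly before Q. *)
Lemma first_time_ltP (Q N : pred nat) : (forall n, Q n -> ~~ N n) ->
  time_lt (first_time Q) (first_time N) <->
  exists2 n, Q n & forall k, (k < n)%N -> ~~ Q k /\ ~~ N k.
Proof.
move=> QN; split=> [|[n Qn nQN]].
  case: first_timeP => // n Qn nQ; case: first_timeP => [m _ nN nm|nN _].
    by exists n => // k kn; rewrite nQ// nN// (ltn_trans kn nm).
  by exists n => // k kn; rewrite nQ// nN.
rewrite (first_time_some Qn); last by move=> k /nQN[].
case: first_timeP => // m Nm _ /=; rewrite ltnNge; apply/negP.
rewrite leq_eqVlt => /predU1P[mn|/nQN[_]]; last by rewrite Nm.
by move: (QN _ Qn); rewrite -mn Nm.
Qed.

Section walk_expectation.
Context d (T : measurableType d) (R : realType) (P : probability T R).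
Variables (C : nat -> {RV P >-> nat}) (p : nat -> R) (v : R).
Hypotheses (p_ge0 : forall k, 0 <= p k) (C_iid : iid_with_pmf C p).
Hypotheses (v_ge0 : 0 <= v) (v_le1 : v <= 1).

Lemma weightE s : weight p v s = v ^+ size s * \prod_(c <- s) p c.
Proof.
by rewrite /weight big_split/= big_const_seq count_predT iter_mulr_1.
Qed.

(** The weight is at most the probability of the word, so the sum is at most 1
    by Kraft's inequality. *)
Lemma hit_sum_fin_num (Q N : pred int) (h : int -> R) x :
  (forall y, 0 <= h y) -> (forall y, Q y -> h y <= 1) -> hit_sum p v Q N h x \is a fin_num.
Proof.
move=> h0 h1; rewrite ge0_fin_numE; last exact: hit_sum_ge0.
apply: (@le_lt_trans _ _ 1%E); last exact: ltry.
apply: le_trans (kraft p_ge0 C_iid (@hits_prefix_free Q N x)).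
apply: le_esum => s [Qs _]; rewrite lee_fin weightE.
have pp : 0 <= \prod_(c <- s) p c by exact: prodr_ge0.
rewrite -mulrA mulrCA ler_piMr// mulr_ile1 ?exprn_ge0 ?h1//.
by rewrite exprn_ile1.
Qed.

(** The event holds exactly when some initial segment of the jump sequence
    lies in [hits Q N x], and this segment determines the integrand. *)
Lemma E_on_hit_sum (Q N : pred int) Y (h : int -> R) x :
  (forall y, Q y -> ~~ N y) -> (forall y, 0 <= h y) ->
  (forall X n, Q (X n) -> (forall k, (k < n)%N -> ~~ Q (X k)) ->
    Y X = v ^+ n * h (X n)) ->
  E_on C x Y [set X | time_lt (first_time (fun n => Q (X n)))
                              (first_time (fun n => N (X n)))] =
  hit_sum p v Q N h x.
Proof.
move=> QN h0 Yh; rewrite /E_on.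
rewrite (expectation_prefix_free p_ge0 C_iid (@hits_prefix_free Q N x)
  (g := fun s => v ^+ size s * h (endpoint x s))).
- apply: eq_esum => s _; rewrite weightE; congr EFin; ring.
- by move=> s; rewrite mulr_ge0 ?exprn_ge0.
- move=> s om [Qs nQN] cs.
  have ws : endpoint x s = walk C x om (size s) by rewrite walkE cs.
  have Qw : Q (walk C x om (size s)) by rewrite -ws.
  have nw k : (k < size s)%N ->
      ~~ Q (walk C x om k) /\ ~~ N (walk C x om k).
    by move=> ks; rewrite !walkE -(take_jumps _ _ (ltnW ks)) cs; exact: nQN.
  rewrite ws (Yh _ (size s))//; last by move=> k /nw[].
  rewrite indicE mem_set ?mulr1//=; apply/first_time_ltP.
    by move=> n; exact: QN.
  by exists (size s).
- move=> om none; rewrite indicE memNset ?mulr0//= => /first_time_ltP[].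
    by move=> n; exact: QN.
  move=> n Qn nQN; apply: (none (jumps C om n)); last first.
    by rewrite /cylinder/= size_jumps.
  split; first by rewrite -walkE.
  move=> k; rewrite size_jumps => kn.
  by rewrite take_jumps ?(ltnW kn)// -walkE; exact: nQN.
Qed.

End walk_expectation.

(** * The two-sided exit problem *)

Definition below0 : pred int := fun z => z <= -1.
Definition above (y : int) : pred int := fun z => y <= z.

Lemma below0_notin_above (y z : int) : 0 <= y -> below0 z -> ~~ above y z.
Proof. by rewrite /below0 /above; lia. Qed.

Lemma above_notin_below0 (y z : int) : 0 <= y -> above y z -> ~~ below0 z.
Proof. by rewrite /below0 /above; lia. Qed.

Lemma below0D_above (b : int) : 0 <= b ->
  (fun z => below0 z && ~~ above b z) = below0.
Proof. by move=> b0; apply/funext => z; rewrite /above /below0 /=; lia. Qed.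

Lemma aboveD_above (x b : int) : x <= b ->
  (fun z => above b z && ~~ above x z) = pred0.
Proof. by move=> xb; apply/funext => z; rewrite /above /=; lia. Qed.

Lemma below0U_aboveD_above (x b : int) : x <= b ->
  (fun z => below0 z || above b z && ~~ above x z) = below0.
Proof.
by move=> xb; apply/funext => z; rewrite (congr1 (@^~ z) (aboveD_above xb)) orbF.
Qed.

Lemma exprz_below0_le1 (R : realType) (w : R) (z : int) :
  0 <= w -> w <= 1 -> below0 z -> w ^ (- z) <= 1.
Proof.
rewrite /below0 => w0 w1 z0; have -> : - z = `|z|%N%:Z by lia.
by rewrite -exprnP exprn_ile1.
Qed.

Section fluctuation.
Context d (T : measurableType d) (R : realType) (P : probability T R).
Variables (C : nat -> {RV P >-> nat}) (p : nat -> R) (v : R).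
Hypotheses (p_ge0 : forall k, 0 <= p k) (p0_gt0 : 0 < p 0%N).
Hypotheses (C_iid : iid_with_pmf C p) (v_gt0 : 0 < v) (v_le1 : v <= 1).

Let v_ge0 : 0 <= v := ltW v_gt0.

Definition ascent (x y : int) : \bar R :=
  hit_sum p v (above y) below0 (fun=> 1) x.

Definition descent (w : R) (N : pred int) (x : int) : \bar R :=
  hit_sum p v below0 N (fun z => w ^ (- z)) x.

Lemma ascent_fin_num x y : ascent x y \is a fin_num.
Proof. exact: (hit_sum_fin_num p_ge0 C_iid). Qed.

Lemma descent_fin_num (w : R) N x : 0 < w -> w <= 1 ->
  descent w N x \is a fin_num.
Proof.
move=> w0 w1; apply: (hit_sum_fin_num p_ge0 C_iid) => // z.
  by rewrite exprz_ge0// ltW.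
by apply: exprz_below0_le1; rewrite // ltW.
Qed.

Lemma exit_belowE (w : R) X n : below0 (X n) ->
  (forall k, (k < n)%N -> ~~ below0 (X k)) ->
  exit_below v w X = v ^+ n * w ^ (- X n).
Proof.
move=> Xn nX; rewrite /exit_below /tau_minus.
by rewrite (first_time_some (Q := fun n => below0 (X n)) Xn nX).
Qed.

Lemma E_exit_below (w : R) (b x : int) : 0 < w -> 0 <= b ->
  E_on C x (exit_below v w)
    [set X | time_lt (tau_minus (-1) X) (tau_plus b X)] = descent w (above b) x.
Proof.
move=> w0 b0.
apply: (E_on_hit_sum p_ge0 C_iid v_ge0 (Q := below0) (N := above b)).
- by move=> y; exact: below0_notin_above.
- by move=> y; rewrite exprz_ge0// ltW.
- exact: exit_belowE.
Qed.

Lemma PsiE (w : R) x : 0 < w -> Psi C v x w = fine (descent w pred0 x).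
Proof.
move=> w0; rewrite /Psi.
have <- : first_time (fun n => pred0 n) = None.
  by case: first_timeP.
congr fine.
apply: (E_on_hit_sum p_ge0 C_iid v_ge0 (Q := below0) (N := pred0)) => //.
- by move=> y; rewrite exprz_ge0// ltW.
- exact: exit_belowE.
Qed.

Lemma WE (y : int) : 0 <= y -> W C p v y = (p 0%N * fine (ascent 0 y))^-1.
Proof.
move=> y0; rewrite /W y0; congr (_ * fine _)^-1.
apply: (E_on_hit_sum p_ge0 C_iid v_ge0 (Q := above y) (N := below0)) => //.
  by move=> z; exact: above_notin_below0.
move=> X n Xn nX; rewrite mulr1 /tau_plus.
by rewrite (first_time_some (Q := fun n => above y (X n)) Xn nX).
Qed.

Lemma endpoint_nseq0 x n : endpoint x (nseq n 0%N) = x + n%:Z.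
Proof. by rewrite /endpoint size_nseq big1_seq ?subr0// => c /nseqP[->]. Qed.

(** The word of n zero jumps climbs straight from 0 to n, and p_0 > 0. *)
Lemma ascent0_gt0 (y : int) : 0 <= y -> 0 < fine (ascent 0 y).
Proof.
case: y => // n _; set s := nseq n 0%N.
have hs : hits (above n) below0 0 s.
  split; first by rewrite endpoint_nseq0 /above add0r.
  move=> k; rewrite size_nseq => kn.
  by rewrite take_nseq ?(ltnW kn)// endpoint_nseq0 /above /below0; lia.
have s_gt0 : 0 < weight p v s.
  by rewrite /weight big_seq prodr_gt0// => c /nseqP[-> _]; rewrite mulr_gt0.
rewrite -lte_fin fineK ?ascent_fin_num//.
apply: (@lt_le_trans _ _ (weight p v s * 1)%:E); first by rewrite lte_fin mulr1.
apply: esum_ge; exists [set s]; last by rewrite fsbig_set1.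
by split; [exact: finite_set1|move=> _ ->].
Qed.

(** To reach b from 0 the walk must first reach x. *)
Lemma ascent_split (x b : int) : 0 <= x -> x <= b ->
  ascent 0 b = (ascent 0 x * ascent x b)%E.
Proof.
move=> x0 xb.
rewrite /ascent (hit_sum_strong_markov (M := above x) (y := x) p_ge0 v_ge0)//.
- rewrite below0U_aboveD_above// aboveD_above//.
  rewrite [X in (_ + X)%E](_ : _ = 0%E) ?adde0//.
  by apply: esum1 => s [].
- exact: ascent_fin_num.
- by move=> s; exact: hits_up_endpoint.
Qed.

(** A walk that goes below 0 either reaches b before, or it does not. *)
Lemma descent_split (w : R) (x b : int) : 0 < w -> w <= 1 -> x <= b -> 0 <= b ->
  descent w pred0 x = (ascent x b * descent w pred0 b + descent w (above b) x)%E.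
Proof.
move=> w0 w1 xb b0.
rewrite {1}/descent (hit_sum_strong_markov (M := above b) (y := b) p_ge0 v_ge0)//.
- by rewrite below0D_above.
- by move=> z; rewrite exprz_ge0// ltW.
- exact: descent_fin_num.
- by move=> s; exact: hits_up_endpoint.
Qed.

(** For x >= 0 this is the splitting of the ascent from 0 to b at x; for x < 0
    both sides vanish, the walk being below 0 from the start. *)
Lemma ascentE (x b : int) : x <= b -> 0 <= b ->
  fine (ascent x b) = W C p v x / W C p v b.
Proof.
move=> xb b0; have [x0|x0] := leP 0 x; last first.
  rewrite {1}/W leNgt x0 mul0r /ascent /hit_sum esum1// => s [+ Hs].
  case: s Hs => [|c s] Hs; first by rewrite endpoint_nil /above; lia.
  have /Hs[_] : (0 < size (c :: s))%N by [].
  by rewrite take0 endpoint_nil /below0; lia.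
have := ascent0_gt0 x0; have := ascent0_gt0 b0.
rewrite !WE// (ascent_split x0 xb).
rewrite fineM ?ascent_fin_num// invrK => ub ux.
by field; rewrite !gt_eqF.
Qed.

End fluctuation.

Unset Implicit Arguments.

Theorem mainTheorem2 (d : measure_display) (T : measurableType d)
  (R : realType) (P : probability T R)
  (p : nat -> R) (p_pmf : is_pmf p) (p0_gt0 : 0 < p 0%N)
  (C : nat -> {RV P >-> nat}) (C_iid : iid_with_pmf C p)
  (v w : R) (v_gt0 : 0 < v) (v_le1 : v <= 1) (w_gt0 : 0 < w) (w_le1 : w <= 1)
  (x b : int) (x_le_b : x <= b) (b_ge0 : 0 <= b) :
  E_on C x (exit_below v w)
    [set X | time_lt (tau_minus (-1) X) (tau_plus b X)] =
  (Z C p v x w - W C p v x / W C p v b * Z C p v b w)%:E.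
Proof.
have [p_ge0 _] := p_pmf.
have Wb0 : W C p v b != 0.
  rewrite (WE p_ge0 C_iid)// invr_eq0 mulf_neq0 ?gt_eqF//.
  exact: (ascent0_gt0 p_ge0 p0_gt0 C_iid).
have descent_fin N y : descent p v w N y \is a fin_num.
  exact: (descent_fin_num p_ge0 C_iid).
have ascent_fin y z := ascent_fin_num p_ge0 C_iid v_gt0 v_le1 y z.
rewrite (E_exit_below p_ge0 C_iid)// -(fineK (descent_fin _ _)); congr EFin.
have := congr1 fine
  (descent_split p_ge0 C_iid v_gt0 v_le1 w_gt0 w_le1 x_le_b b_ge0).
rewrite fineD ?fin_numM// fineM// (ascentE p_ge0 p0_gt0 C_iid)//.
rewrite /Z !(PsiE p_ge0 C_iid)// => ->.
by field.
Qed.
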